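(* Let $X\in\mathbb{R}^m$ be a random vector, whose density $f$ is supported on the whole of $\mathbb{R}^m$, and for which there exists some $s>0$ such that $\mathbb{E}(\|X\|^s)<\infty$. Then $H(f)$ is finite and satisfies $$H(f)\leq\frac{m}{s}\log\big(c_1(m,s)\,\mathbb{E}\|X\|^s\big),$$ where $$c_1(m,s)=\left(\frac{\pi^{m/2}\,\Gamma(m/s+1)}{\Gamma(m/2+1)}\right)^{s/m}\left(\frac{se}{m}\right),$$ with equality if and only if $X\sim \mathit{GG}_\tau(m,s)$ with $\tau=m/(s\,\mathbb{E}\|X\|^s)$.
   Context: Here $m\geq 1$ is an integer, $\|\cdot\|$ is the Euclidean norm on $\mathbb{R}^m$, $\log$ is the natural logarithm, $e$ is Euler's number, and $\Gamma$ is the gamma function. The differential (Shannon) entropy of a density $f$ on $\mathbb{R}^m$ is $H(f)=-\int_{\mathbb{R}^m}f(x)\log f(x)\,dx$. For $\tau>0$ and $s>0$, the generalized Gaussian distribution $\mathit{GG}_\tau(m,s)$ on $\mathbb{R}^m$ is the distribution with density function $$x\mapsto c(m,s)\exp\left(-\tau\|x\|^s\right),\quad x\in\mathbb{R}^m,\qquad c(m,s)=\frac{\Gamma(m/2+1)\,\tau^{m/s}}{\Gamma(m/s+1)\,\pi^{m/2}}.$$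
   Formalization: H(f) can be −∞ under the stated hypotheses (f with ever higher, narrower peaks), so ''H(f) is finite'' is replaced by H(f) < +∞ always, and H(f) finite when the positive part of f log f is integrable; the bound and the equality case are unchanged. *)

(* Defs.v *)
From HB Require Import structures.
From mathcomp Require Import all_boot all_order all_algebra.
From mathcomp Require Import all_classical all_reals all_analysis.

Set Implicit Arguments.
Unset Strict Implicit.
Unset Printing Implicit Defensive.

Import Order.TTheory GRing.Theory Num.Theory.
Import numFieldNormedType.Exports.

Local Open Scope classical_set_scope.
Local Open Scope ring_scope.

(* R^n is represented by n.-tuple R, on which the library puts the product of
   the Borel sigma-algebras of R. *)
Section lebesgue_tuple.
Context {R : realType}.

(* The new coordinate is the second component of p because \x requires a
   sigma-finite measure on the right only. *)
Definition cons_pair n (p : n.-tuple R * measurableTypeR R) : n.+1.-tuple R :=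
  [tuple of p.2 :: p.1].

Lemma measurable_cons_pair n : measurable_fun setT (@cons_pair n).
Proof.
exact: (@measurable_cons _ _ _ R snd n fst measurable_snd measurable_fst).
Qed.

Section lebesgue_step.
Variables (n : nat) (mu : {measure set (n.-tuple R) -> \bar R}).

Definition lebesgue_step : set (n.+1.-tuple R) -> \bar R :=
  pushforward (mu \x @lebesgue_measure R)%E (@cons_pair n).

Let lebesgue_step0 : lebesgue_step set0 = 0%E.
Proof. by rewrite /lebesgue_step /pushforward preimage_set0 measure0. Qed.

Let lebesgue_step_ge0 A : (0 <= lebesgue_step A)%E.
Proof. by rewrite /lebesgue_step /pushforward measure_ge0. Qed.

Let lebesgue_step_additive : semi_sigma_additive lebesgue_step.
Proof.
move=> F mF tF mUF; rewrite /lebesgue_step /pushforward preimage_bigcup.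
apply: measure_semi_sigma_additive.
- by move=> k; rewrite -[X in measurable X]setTI; exact: measurable_cons_pair.
- apply/trivIsetP => /= i j _ _ ij; rewrite -preimage_setI.
  by move/trivIsetP : tF => /(_ _ _ _ _ ij) ->//; rewrite preimage_set0.
- by rewrite -preimage_bigcup -[X in measurable X]setTI;
    exact: measurable_cons_pair.
Qed.

HB.instance Definition _ := isMeasure.Build _ _ _ lebesgue_step
  lebesgue_step0 lebesgue_step_ge0 lebesgue_step_additive.

End lebesgue_step.

Fixpoint lebesgue_tuple n : {measure set (n.-tuple R) -> \bar R} :=
  match n with
  | 0 => dirac [tuple]
  | n'.+1 => lebesgue_step (lebesgue_tuple n')
  end.

Lemma lebesgue_tuple_box n (B : 'I_n -> set (measurableTypeR R)) :
    (forall i, measurable (B i)) ->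
  lebesgue_tuple n [set x | forall i, B i (tnth x i)] =
  (\prod_(i < n) lebesgue_measure (B i))%E.
Proof.
elim: n B => [|n IH] B mB.
  rewrite big_ord0 /= diracE mem_set// => -[]//.
rewrite big_ord_recl /= /lebesgue_step /pushforward.
have -> : @cons_pair n @^-1` [set x | forall i, B i (tnth x i)] =
    [set x | forall i, B (lift ord0 i) (tnth x i)] `*` B ord0.
  apply/seteqP; split => -[x r] /=.
    move=> Bx; split => [i|]; last exact: (Bx ord0).
    by have := Bx (lift ord0 i); rewrite tnthS.
  move=> [Bx Br] i; have [->//|i0] := eqVneq i ord0.
  have /unlift_some [j -> _] : ord0 != i by rewrite eq_sym.
  by rewrite tnthS.
have mC : measurable [set x : n.-tuple R |
    forall i, B (lift ord0 i) (tnth x i)].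
  rewrite (_ : mkset _ = \bigcap_(i in [set: 'I_n])
      ((@tnth n R ^~ i) @^-1` B (lift ord0 i))); last first.
    by apply/seteqP; split => x /= Bx i; [move=> _|]; exact: Bx.
  apply: fin_bigcap_measurable => // i _.
  rewrite -[X in measurable X]setTI.
  exact: (@measurable_tnth _ R n i measurableT _ (mB (lift ord0 i))).
rewrite product_measure1E//= muleC; congr (_ * _)%E.
by apply: IH => i.
Qed.

End lebesgue_tuple.

Section entropy.
Context {R : realType}.
Local Open Scope ereal_scope.

Definition Gamma (z : R) : R :=
  Rintegral (@lebesgue_measure R) `]0%R, +oo[
    (fun t => t `^ (z - 1) * expR (- t))%R.

Definition edist n (x y : n.-tuple R) : R :=
  Num.sqrt (\sum_(i < n) (tnth x i - tnth y i) ^+ 2)%R.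

Definition enorm n (x : n.-tuple R) : R :=
  Num.sqrt (\sum_(i < n) tnth x i ^+ 2)%R.

Definition has_density d (T : measurableType d) (P : probability T R) n
    (X : {RV P >-> n.-tuple R}) (f : n.-tuple R -> R) : Prop :=
  [/\ measurable_fun [set: n.-tuple R] f,
      (forall x, (0 <= f x)%R) &
      (forall A, measurable A ->
        distribution P X A = \int[lebesgue_tuple n]_(x in A) (f x)%:E)].

(* The closure of [set x | f x != 0] for the Euclidean metric is R^n; this is
   weaker than f being positive everywhere, or almost everywhere. *)
Definition full_support n (f : n.-tuple R -> R) : Prop :=
  forall x (r : R), (0 < r)%R -> exists y, (edist x y < r)%R /\ f y != 0%R.

(* The integrand is 0 where f is 0, because of the factor f x. As the integral
   is the difference of the integrals of the positive and negative parts, with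
   +oo - +oo = -oo, the inequality entropy f < +oo implies that
   - f * ln f has an integrable positive part. The value -oo is possible, even
   when all moments are finite: f may have arbitrarily high and narrow peaks. *)
Definition entropy n (f : n.-tuple R -> R) : \bar R :=
  - \int[lebesgue_tuple n]_x (f x * ln (f x))%:E.

Definition gg_const n (tau s : R) : R :=
  (Gamma (n%:R / 2 + 1) * tau `^ (n%:R / s) /
   (Gamma (n%:R / s + 1) * pi `^ (n%:R / 2)))%R.

Definition gg_density n (tau s : R) (x : n.-tuple R) : R :=
  (gg_const n tau s * expR (- (tau * enorm x `^ s)))%R.

Definition c1 n (s : R) : R :=
  ((pi `^ (n%:R / 2) * Gamma (n%:R / s + 1) / Gamma (n%:R / 2 + 1))
     `^ (s / n%:R) * (s * expR 1 / n%:R))%R.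

End entropy.

(* Main.v *)
(** Let g be the density of GG_tau(m,s) with tau = m / (s M), M = E |X|^s. Then
    - int f ln g = tau M - ln c(m,s) is exactly the bound, because ln g is an
    affine function of |x|^s, and Gibbs' inequality int f ln f >= int f ln g,
    strict unless f = g almost everywhere, gives the bound and the equality
    case.

    That g integrates to 1 comes from int exp (- tau |x|^s) dx =
    V tau^(-m/s) Gamma(m/s + 1), where V is the volume of the unit ball: write
    exp (- u) as the integral of exp (- y) over y > u and exchange the
    integrals. For s = 2 and tau = 1 the left-hand side is a product of Gaussian
    integrals, so V Gamma(m/2 + 1) = pi^(m/2); this also shows that V and the
    Gamma integrals are finite and positive. *)
Require Import Defs.
From HB Require Import structures.
From mathcomp Require Import all_boot all_order all_algebra.
From mathcomp Require Import all_classical all_reals all_analysis.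
From mathcomp Require Import measurable_realfun ring lra.
Import Order.TTheory GRing.Theory Num.Theory.
Import numFieldNormedType.Exports.
Local Open Scope classical_set_scope.
Local Open Scope ring_scope.
Local Open Scope ereal_scope.

(** * Lebesgue measure on tuples and iterated integrals *)

(* [lebesgue_tuple] as a set function, so that it can carry the
   sigma-finite structure that Tonelli's theorem requires. *)
Definition lebesgue_vec {R : realType} n : set (n.-tuple R) -> \bar R :=
  lebesgue_tuple n.

HB.instance Definition _ (R : realType) n :=
  Measure.copy (@lebesgue_vec R n) (@lebesgue_tuple R n).

Lemma tnth_box_bigcap {R : realType} {n} (B : 'I_n -> set R) :
  [set x : n.-tuple R | forall i, B i (tnth x i)] =
  \bigcap_(i in [set: 'I_n]) ((@tnth n R ^~ i) @^-1` B i).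
Proof. by apply/seteqP; split => x /= Bx i; [move=> _|]; exact: Bx. Qed.

Lemma measurable_box {R : realType} {n} (B : 'I_n -> set R) :
  (forall i, measurable (B i)) ->
  measurable [set x : n.-tuple R | forall i, B i (tnth x i)].
Proof.
move=> mB; rewrite tnth_box_bigcap.
apply: fin_bigcap_measurable => // i _; rewrite -[X in measurable X]setTI.
exact: (@measurable_tnth _ R n i measurableT _ (mB i)).
Qed.

Lemma lebesgue_vec_sigma_finite {R : realType} n :
  sigma_finite [set: n.-tuple R] (@lebesgue_vec R n).
Proof.
exists (fun k => [set x : n.-tuple R |
    forall i : 'I_n, `](- k%:R)%R, k%:R%R]%classic (tnth x i)]).
  apply/seteqP; split => // x _.
  (* One more than the largest integer part of the |x_i| strictly exceeds every |x_i|; strictness is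
     needed at the open left end of the interval. *)
  exists (\max_(i < n) (Num.truncn `|tnth x i|).+1)%N => // i /=.
  rewrite in_itv/=; apply/andP.
  have : (`|tnth x i| < (\max_(i < n) (Num.truncn `|tnth x i|).+1)%:R)%R.
    apply: (@lt_le_trans _ _ ((Num.truncn `|tnth x i|).+1%:R)).
      exact: truncnS_gt.
    by rewrite ler_nat (leq_bigmax (F := fun i => (Num.truncn `|tnth x i|).+1)).
  by rewrite ltr_norml => /andP[-> /ltW].
pose I (k : nat) (i : 'I_n) : set R := `](- k%:R)%R, k%:R%R]%classic.
have mI k i : measurable (I k i : set (measurableTypeR R)).
  exact: measurable_itv.
move=> k; split; first exact: (measurable_box (I k) (mI k)).
rewrite /lebesgue_vec (@lebesgue_tuple_box _ _ (I k))//.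
rewrite (eq_bigr
    (fun=> (fine (@lebesgue_measure R `](- k%:R)%R, k%:R%R]))%:E)).
  by rewrite prodEFin ltry.
move=> i _; rewrite fineK// lebesgue_measure_itv/=.
by case: ifPn => // _; rewrite -EFinB.
Qed.

HB.instance Definition _ (R : realType) n := @Measure_isSigmaFinite.Build
  _ _ _ (@lebesgue_vec R n) (lebesgue_vec_sigma_finite n).

(** Tonelli for the last added coordinate: the measure in dimension n + 1 is by construction the
    image of a product measure under [cons_pair]. *)
Lemma ge0_integral_lebesgue_vecS {R : realType} n
    (h : n.+1.-tuple R -> \bar R) :
  measurable_fun [set: n.+1.-tuple R] h -> (forall x, 0 <= h x) ->
  \int[lebesgue_vec n.+1]_x h x =
  \int[lebesgue_vec n]_x \int[lebesgue_measure]_y h [tuple of y :: x].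
Proof.
move=> mh h0.
transitivity (\int[pushforward (lebesgue_vec n \x lebesgue_measure)
    (@cons_pair R n)]_x h x); first by [].
rewrite ge0_integral_pushforward//; last exact: measurable_cons_pair.
rewrite fubini_tonelli1//=.
by apply: measurableT_comp => //; exact: measurable_cons_pair.
Qed.

(** * The Euclidean norm and dilations *)

Lemma measurable_enorm {R : realType} n :
  measurable_fun [set: n.-tuple R] (@enorm R n).
Proof.
apply: (@measurableT_comp _ _ _ _ _ _ (@Num.sqrt R)).
  apply: continuous_measurable_fun; exact: sqrt_continuous.
apply: measurable_sum => i.
by apply/measurable_funX; exact: measurable_tnth.
Qed.

Lemma measurable_enorm_powR {R : realType} n (s : R) :
  measurable_fun [set: n.-tuple R] (fun x => enorm x `^ s)%R.
Proof.
by apply: (measurableT_comp (measurable_powR s)); exact: measurable_enorm.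
Qed.

Definition scale_vec {R : realType} n (r : R) (x : n.-tuple R) : n.-tuple R :=
  [tuple (r * tnth x i)%R | i < n].

Lemma measurable_scale_vec {R : realType} n (r : R) :
  measurable_fun [set: n.-tuple R] (@scale_vec R n r).
Proof.
apply/measurable_fun_tnthP => i.
rewrite (_ : _ \o _ = fun x : n.-tuple R => (r * tnth x i)%R); last first.
  by apply/funext => x /=; rewrite tnth_mktuple.
by apply: measurable_funM => //; exact: measurable_tnth.
Qed.

Lemma scale_vec_cons {R : realType} n (r y : R) (x : n.-tuple R) :
  scale_vec n.+1 r [tuple of y :: x] = [tuple of (r * y)%R :: scale_vec n r x].
Proof.
apply: eq_from_tnth => i; rewrite tnth_mktuple.
have [->|] := eqVneq i ord0; first by rewrite !tnth0.
rewrite eq_sym => /unlift_some[j -> _].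
by rewrite !tnthS tnth_mktuple.
Qed.

Lemma enorm_scale_vec {R : realType} n (r : R) (x : n.-tuple R) :
  (0 <= r)%R -> enorm (scale_vec n r x) = (r * enorm x)%R.
Proof.
move=> r0; rewrite /enorm.
under eq_bigr do rewrite tnth_mktuple exprMn.
by rewrite -mulr_sumr sqrtrM ?sqr_ge0// sqrtr_sqr ger0_norm.
Qed.

(** Lebesgue measure equals r times its image under x -> r x: the preimage of ]a, b] is ]a/r, b/r],
    and agreement on such intervals determines the measure. *)
Lemma ge0_integral_lebesgue_scale {R : realType} (r : R) (h : R -> \bar R) :
  (0 < r)%R -> measurable_fun setT h -> (forall x, 0 <= h x) ->
  \int[lebesgue_measure]_x h x =
  r%:E * \int[lebesgue_measure]_x h (r * x)%R.
Proof.
move=> r0 mh h0.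
have mr : measurable_fun setT
    (fun x : measurableTypeR R => (r * x)%R : measurableTypeR R).
  exact: measurable_funM.
pose rn : {nonneg R} := NngNum (ltW r0).
pose nu : {measure set (measurableTypeR R) -> \bar R} :=
  measure_function_pushforward__canonical__measure_function_Measure
    lebesgue_measure mr.
transitivity (\int[mscale rn nu]_x h x).
  apply: eq_measure_integral => A mA _.
  apply: lebesgue_measure_unique => // _ [[a b] _ <-].
  rewrite /= /mscale /= /pushforward.
  rewrite (_ : _ @^-1` _ = `](a / r)%R, (b / r)%R]%classic); last first.
    apply/seteqP; split => x /=; rewrite !in_itv/=;
    by rewrite ltr_pdivrMr// ler_pdivlMr// mulrC.
  rewrite !lebesgue_measure_itv/= !lte_fin ltr_pM2r ?invr_gt0//.
  case: ifPn => ab; last by rewrite mule0.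
  by rewrite -!EFinB -EFinM -mulrBl mulrCA divff ?mulr1// gt_eqF.
rewrite ge0_integral_mscale//.
by rewrite ge0_integral_pushforward.
Qed.

Lemma ge0_integral_lebesgue_vec_scale {R : realType} n (r : R)
    (h : n.-tuple R -> \bar R) :
  (0 < r)%R -> measurable_fun [set: n.-tuple R] h -> (forall x, 0 <= h x) ->
  \int[lebesgue_vec n]_x h x =
  (r ^+ n)%:E * \int[lebesgue_vec n]_x h (scale_vec n r x).
Proof.
move=> r0; elim: n => [|n IH] in h * => mh h0.
  rewrite expr0 mul1e; apply: eq_integral => x _; congr h.
  by apply: eq_from_tnth => -[].
rewrite ge0_integral_lebesgue_vecS//.
have mF (g : n.+1.-tuple R -> \bar R) :
    measurable_fun [set: n.+1.-tuple R] g -> (forall x, 0 <= g x) ->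
    measurable_fun [set: n.-tuple R]
      (fun x => \int[lebesgue_measure]_y g [tuple of y :: x]).
  move=> mg g0.
  have mcons : measurable_fun setT
      (fun p : n.-tuple R * measurableTypeR R => g [tuple of p.2 :: p.1]).
    by apply: measurableT_comp => //; exact: measurable_cons_pair.
  exact: (@measurable_fun_fubini_tonelli_F _ _ _ _ _ lebesgue_measure _ mcons).
have mhx (x : n.-tuple R) :
    measurable_fun setT (fun y : R => h [tuple of y :: x]).
  by apply: measurableT_comp => //; exact: measurable_cons.
have mhs : measurable_fun [set: n.+1.-tuple R] (h \o scale_vec n.+1 r).
  by apply: measurableT_comp => //; exact: measurable_scale_vec.
rewrite (IH _ (mF _ mh h0))//; last by move=> x; exact: integral_ge0.
(* The induction hypothesis has supplied r^n; the remaining factor r is absorbed by rescaling the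
   new coordinate. *)
rewrite exprSr EFinM -muleA; congr *%E.
rewrite ge0_integral_lebesgue_vecS// -ge0_integralZl//; last 3 first.
- by apply: (mF _ mhs) => x; exact: h0.
- by move=> x _; exact: integral_ge0.
- by rewrite lee_fin ltW.
apply: eq_integral => x _.
rewrite (ge0_integral_lebesgue_scale r)//.
by under [in RHS]eq_integral do rewrite scale_vec_cons.
Qed.

(** * Volumes of balls *)

Definition volume_ball1 {R : realType} n : \bar R :=
  @lebesgue_vec R n [set x | (enorm x < 1)%R].

Lemma measurable_enorm_lt {R : realType} n (r : R) :
  measurable [set x : n.-tuple R | (enorm x < r)%R].
Proof.
rewrite -[X in measurable X]setTI.
have := measurable_enorm n measurableT _ (measurable_itv `]-oo, r[).
by rewrite (_ : _ @^-1` _ = [set x : n.-tuple R | (enorm x < r)%R]).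
Qed.

(** Dilating by r turns the indicator of the ball of radius r into that of the unit ball. The volume
    is not yet known to be finite. *)
Lemma lebesgue_vec_ball {R : realType} n (r : R) : (0 < r)%R ->
  lebesgue_vec n [set x | (enorm x < r)%R] = (r ^+ n)%:E * volume_ball1 n.
Proof.
move=> r0.
have volE t : lebesgue_vec n [set x | (enorm x < t)%R] =
    \int[lebesgue_vec n]_x
      (\1_[set x : n.-tuple R | (enorm x < t)%R] x : R)%:E.
  by rewrite integral_indic ?setIT//; exact: measurable_enorm_lt.
rewrite /volume_ball1 !volE (ge0_integral_lebesgue_vec_scale n r)//; last first.
  apply/measurable_EFinP; apply: measurable_indic.
  exact: measurable_enorm_lt.
congr *%E; apply: eq_integral => x _; rewrite !indicE.
congr (_%:R%:E); congr nat_of_bool.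
by apply/idP/idP; rewrite !inE/= enorm_scale_vec ?(ltW r0)// gtr_pMr.
Qed.

(** * Radial exponential integrals *)

Lemma integral_expRN_tail {R : realType} (u : R) :
  \int[lebesgue_measure]_(t in `]u, +oo[) (expR (- t))%:E = (expR (- u))%:E.
Proof.
have cexpN : continuous (fun z : R => expR (- z)).
  move=> z; apply: continuous_comp; last exact: continuous_expR.
  exact: (@continuousN _ R^o).
rewrite integral_itv_obnd_cbnd; last first.
  apply/measurable_EFinP/measurable_funTS; exact: continuous_measurable_fun.
rewrite (@ge0_continuous_FTC2y _ _ (fun x => - expR (- x))%R _ 0%R).
- by rewrite add0e EFinN oppeK.
- by move=> x _; exact: expR_ge0.
- exact: continuous_subspaceT.
- by rewrite -oppr0; apply: cvgN; exact: cvgr_expR.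
- by move=> x _; exact: ex_derive.
- by apply: cvgN; apply/cvg_at_right_filter; exact: cexpN.
- move=> x _; rewrite derive1E deriveN// -derive1E derive1_comp//.
  rewrite derive1N// derive1_id mulrN1 opprK derive1E.
  by have /funeqP -> := @derive_expR R.
Qed.

(** The integral defining Gamma(a + 1), kept in [\bar R]: [Gamma] goes through [fine], which would
    turn an infinite value into 0. *)
Definition moment_expRN {R : realType} (a : R) : \bar R :=
  \int[lebesgue_measure]_(t in `]0%R, +oo[) (t `^ a * expR (- t))%:E.

Lemma Gamma_moment {R : realType} (a : R) :
  Gamma (a + 1) = fine (moment_expRN a).
Proof. by rewrite /Gamma /Rintegral addrK. Qed.

Lemma powRV_lt {R : realType} (tau s r y : R) :
    (0 < tau)%R -> (0 < s)%R -> (0 < y)%R -> (0 <= r)%R ->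
  (tau * r `^ s < y)%R = (r < (y / tau) `^ s^-1)%R.
Proof.
move=> tau0 s0 y0 r0; rewrite mulrC -ltr_pdivlMr//.
have yt0 : (0 < y / tau)%R by exact: divr_gt0.
rewrite -{1}(powRr1 (ltW yt0)) -(mulVf (lt0r_neq0 s0)) powRrM !ltNge.
congr negb; apply/idP/idP => [|yr].
  rewrite !leNgt; apply: contra => ry.
  by rewrite gt0_ltr_powR// nnegrE powR_ge0.
by rewrite ge0_ler_powR// ?nnegrE ?powR_ge0// ltW.
Qed.

Lemma measurable_powR_expRN {R : realType} (a : R) :
  measurable_fun setT (fun t : R => (t `^ a * expR (- t))%R).
Proof.
apply: measurable_funM; first exact: measurable_powR.
exact: (measurableT_comp (@measurable_expR R)).
Qed.

(** Tonelli requires only nonnegativity, so this holds in [\bar R] before either factor on the right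
    is known to be finite, and can be used to prove that they are. *)
Lemma integral_radial_expRN {R : realType} n (tau s : R) :
  (0 < tau)%R -> (0 < s)%R ->
  \int[lebesgue_vec n]_x (expR (- (tau * enorm x `^ s)))%:E =
  volume_ball1 n * (tau `^ (- (n%:R / s)))%:E * moment_expRN (n%:R / s).
Proof.
move=> tau0 s0.
pose U (x : n.-tuple R) := (tau * enorm x `^ s)%R.
have mU : measurable_fun [set: n.-tuple R] U.
  apply: measurable_funM => //.
  exact: measurable_enorm_powR.
have U0 x : (0 <= U x)%R by rewrite mulr_ge0 ?powR_ge0// ltW.
pose A := [set p : n.-tuple R * measurableTypeR R | (U p.1 < p.2)%R].
have mA : measurable A.
  rewrite -[X in measurable X]setTI.
  have := @measurable_fun_ltr _ _ _ setT (U \o fst)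
    (snd : n.-tuple R * measurableTypeR R -> R).
  move=> /(_ _ _ measurableT [set true]); apply => //.
  by apply: measurableT_comp.
pose h (p : n.-tuple R * measurableTypeR R) : \bar R :=
  (expR (- p.2) * \1_A p)%:E.
have mh : measurable_fun setT h.
  apply/measurable_EFinP; apply: measurable_funM; last exact: measurable_indic.
  apply: (measurableT_comp (@measurable_expR R)).
  by apply: (measurableT_comp (@oppr_measurable R setT)).
have h0 p : 0 <= h p by rewrite lee_fin mulr_ge0 ?expR_ge0.
transitivity (\int[lebesgue_vec n]_x \int[lebesgue_measure]_y h (x, y)).
  apply: eq_integral => x _.
  rewrite -/(U x) -integral_expRN_tail integral_mkcond epatch_indic.
  apply: eq_integral => y _; rewrite /h /= -EFinM !indicE; congr (_ * _%:R)%:E.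
  by congr nat_of_bool; apply/idP/idP; rewrite !inE /A/= in_itv/= andbT.
rewrite (fubini_tonelli _ mh h0).
(* For y > 0 the slice where U < y is the ball of radius (y / tau)^(1/s), so its volume is that of
   the unit ball times y^(n/s) tau^(-n/s). *)
transitivity (\int[lebesgue_measure]_(y in `]0%R, +oo[)
    (volume_ball1 n * (tau `^ (- (n%:R / s)))%:E *
    (y `^ (n%:R / s) * expR (- y))%:E)).
  rewrite [RHS]integral_mkcond; apply: eq_integral => y _.
  transitivity ((expR (- y))%:E * lebesgue_vec n [set x | (U x < y)%R]).
    have mUy : measurable [set x : n.-tuple R | (U x < y)%R].
      rewrite -[X in measurable X]setTI.
      exact: (mU measurableT _ (measurable_itv `]-oo, y[)).
    rewrite -[in RHS](setIT [set x | _]) -integral_indic//.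
    rewrite -ge0_integralZl//.
    by apply/measurable_EFinP; exact: measurable_indic.
  (* As U is nonnegative, the slice is empty for y <= 0. *)
  rewrite patchE; have [y0|y0] := ltP 0%R y; last first.
    rewrite memNset/= ?in_itv/= ?andbT; last by apply/negP; rewrite -leNgt.
    rewrite (_ : [set x | _] = set0) ?measure0 ?mule0//.
    apply/seteqP; split => x //=.
    by move=> /lt_le_trans -/(_ _ y0); rewrite ltNge U0.
  rewrite mem_set/= ?in_itv/= ?y0//.
  have r0 : (0 < (y / tau) `^ s^-1)%R by rewrite powR_gt0// divr_gt0.
  rewrite (_ : [set x | _] =
      [set x : n.-tuple R | (enorm x < (y / tau) `^ s^-1)%R]); last first.
    by apply/seteqP; split => x /=; rewrite /U powRV_lt// sqrtr_ge0.
  rewrite lebesgue_vec_ball//.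
  have -> : (((y / tau) `^ s^-1) ^+ n =
      y `^ (n%:R / s) * tau `^ (- (n%:R / s)))%R.
    rewrite -powR_mulrn ?(ltW r0)// -powRrM (mulrC s^-1%R).
    rewrite powRM ?invr_ge0 ?(ltW y0) ?(ltW tau0)// -(powR_inv1 (ltW tau0)).
    by rewrite -powRrM mulN1r.
  rewrite !EFinM muleC (muleC _ (volume_ball1 n)) -!muleA.
  by rewrite (muleCA (y `^ _)%:E).
rewrite ge0_integralZl//.
- apply/measurable_EFinP/measurable_funTS; exact: measurable_powR_expRN.
- by move=> y _; rewrite lee_fin mulr_ge0 ?powR_ge0 ?expR_ge0.
- by rewrite mule_ge0 ?lee_fin ?powR_ge0// measure_ge0.
Qed.

(** * Positivity and finiteness of the Gamma integrals *)

Lemma moment_expRN_ge0 {R : realType} (a : R) : 0 <= moment_expRN a.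
Proof.
by apply: integral_ge0 => t _; rewrite lee_fin mulr_ge0 ?powR_ge0 ?expR_ge0.
Qed.

(** On t > 1 the factor t^a is at least 1, so the integral is at least the tail exp (- 1). *)
Lemma moment_expRN_gt0 {R : realType} (a : R) :
  (0 <= a)%R -> 0 < moment_expRN a.
Proof.
move=> a0; apply: (@lt_le_trans _ _
    (\int[lebesgue_measure]_(t in `]1%R, +oo[) (expR (- t))%:E)).
  by rewrite integral_expRN_tail lte_fin expR_gt0.
apply: (@le_trans _ _
    (\int[lebesgue_measure]_(t in `]1%R, +oo[) (t `^ a * expR (- t))%:E)).
  apply: ge0_le_integral => //.
  - apply/measurable_EFinP/measurable_funTS.
    exact: (measurableT_comp (@measurable_expR R)).
  - apply/measurable_EFinP/measurable_funTS; exact: measurable_powR_expRN.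
  - move=> t; rewrite /= in_itv/= andbT lee_fin => t1.
    rewrite ler_peMl ?expR_ge0// -[leLHS](powRr0 t).
    by rewrite ler_powR// ltW.
apply: ge0_subset_integral => //.
- apply/measurable_EFinP/measurable_funTS; exact: measurable_powR_expRN.
- by move=> t _; rewrite lee_fin mulr_ge0 ?powR_ge0 ?expR_ge0.
- by move=> t; rewrite /= !in_itv/= !andbT; exact: lt_trans.
Qed.

(** For t > 0 one has t^a <= 1 + t^b: compare with 1 if t <= 1 and with t^b if t > 1. *)
Lemma moment_expRN_lty_le {R : realType} (a b : R) :
  (0 <= a <= b)%R -> moment_expRN b < +oo -> moment_expRN a < +oo.
Proof.
move=> /andP[a0 ab] boo.
have mexp : measurable_fun setT (fun t : R => expR (- t)).
  exact: (measurableT_comp (@measurable_expR R)).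
apply: (@le_lt_trans _ _
    (\int[lebesgue_measure]_(t in `]0%R, +oo[) (expR (- t))%:E +
     moment_expRN b)).
  rewrite /moment_expRN -ge0_integralD//; last 3 first.
  - exact/measurable_EFinP/measurable_funTS.
  - by move=> t _; rewrite lee_fin mulr_ge0 ?powR_ge0 ?expR_ge0.
  - apply/measurable_EFinP/measurable_funTS; exact: measurable_powR_expRN.
  apply: ge0_le_integral => //.
  - by move=> t _; rewrite lee_fin mulr_ge0 ?powR_ge0 ?expR_ge0.
  - apply/measurable_EFinP/measurable_funTS; exact: measurable_powR_expRN.
  - apply/measurable_EFinP/measurable_funTS/measurable_funD => //.
    exact: measurable_powR_expRN.
  - move=> t; rewrite /= in_itv/= andbT -EFinD lee_fin => t0.
    rewrite -{2}(mul1r (expR _)) -mulrDl ler_wpM2r ?expR_ge0//.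
    have [t1|t1] := leP t 1%R.
      rewrite -[leLHS]addr0 lerD ?powR_ge0//.
      by rewrite (le_trans (ge0_ler_powR a0 _ _ t1)) ?powR1// nnegrE ltW.
    rewrite -[leLHS]add0r lerD// ler_powR// ltW//.
by rewrite integral_expRN_tail lte_add_pinfty// ltry.
Qed.

Lemma integral_gauss_vec {R : realType} n :
  \int[@lebesgue_vec R n]_x (expR (- \sum_(i < n) tnth x i ^+ 2))%:E =
  (Num.sqrt pi ^+ n)%:E.
Proof.
have msum k : measurable_fun [set: k.-tuple R]
    (fun x => expR (- \sum_(i < k) tnth x i ^+ 2)%R).
  apply: (measurableT_comp (@measurable_expR R)).
  apply: (measurableT_comp (@oppr_measurable R setT)).
  apply: measurable_sum => i.
  by apply/measurable_funX; exact: measurable_tnth.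
elim: n => [|n IH].
  under eq_integral do rewrite big_ord0 oppr0 expR0.
  rewrite integral_cst// mul1e expr0.
  exact: diracT.
rewrite ge0_integral_lebesgue_vecS//; last first.
  by apply/measurable_EFinP; exact: msum.
under eq_integral => x _.
  under eq_integral => y _.
    rewrite big_ord_recl tnth0 opprD expRD mulrC EFinM.
    under eq_bigr do rewrite tnthS.
    over.
  rewrite ge0_integralZl//; last first.
    by apply/measurable_EFinP; exact: measurable_gauss_fun.
  rewrite integralT_gauss muleC.
  over.
rewrite ge0_integralZl//; last first.
  by apply/measurable_EFinP; exact: msum.
by rewrite IH exprS EFinM.
Qed.

Lemma volume_ball1_ge0 {R : realType} n : 0 <= @volume_ball1 R n.
Proof. exact: measure_ge0. Qed.

Lemma volume_ball1_moment {R : realType} n :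
  volume_ball1 n * moment_expRN (n%:R / 2) = (pi `^ (n%:R / 2) : R)%:E.
Proof.
have := integral_radial_expRN n _ _ (@ltr01 R) (ltr0Sn R 1).
under eq_integral => x _.
  rewrite mul1r powR_mulrn ?sqrtr_ge0// sqr_sqrtr ?sumr_ge0//; last first.
    by move=> i _; exact: sqr_ge0.
  over.
rewrite integral_gauss_vec powR1 mule1 => <-; congr EFin.
by rewrite -powR12_sqrt ?pi_ge0// -powR_mulrn ?powR_ge0// -powRrM mulrC.
Qed.

(** An infinite factor would make the product +oo or, by the convention 0 * +oo = 0, zero; neither
    is a positive real. Applied to [volume_ball1_moment], this makes both the volume and the moment
    finite. *)
Lemma mule_eq_fin_gt0 {R : realType} (x y : \bar R) (r : R) :
    0 <= x -> 0 <= y -> (0 < r)%R -> x * y = r%:E ->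
  (0 < fine x)%R /\ x = (fine x)%:E /\ y = (fine y)%:E.
Proof.
case: x => [x||]//; case: y => [y||]//; rewrite ?lee_fin => x0 y0 r0.
- case=> xyr; split => //=; rewrite lt_neqAle x0 andbT eq_sym.
  by apply: contraPneq r0 => x_eq0; rewrite -xyr x_eq0 mul0r ltxx.
- have [->|xn0] := eqVneq x 0%R; last first.
    by rewrite gt0_muley// lte_fin lt_neqAle eq_sym xn0.
  by rewrite mul0e => -[r_eq0]; rewrite -r_eq0 ltxx in r0.
- have [->|yn0] := eqVneq y 0%R; last first.
    by rewrite gt0_mulye// lte_fin lt_neqAle eq_sym yn0.
  by rewrite mule0 => -[r_eq0]; rewrite -r_eq0 ltxx in r0.
Qed.

(* Every a is at most n / 2 for some n, and the moment of order n / 2 is finite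
   by [volume_ball1_moment]. *)
Lemma moment_expRN_fin {R : realType} (a : R) : (0 <= a)%R ->
  moment_expRN a = (fine (moment_expRN a))%:E.
Proof.
move=> a0; set n := (Num.truncn (2 * a)).+1.
have an : (a <= n%:R / 2)%R.
  by rewrite ler_pdivlMr// mulrC ltW// truncnS_gt.
have [_ [_ momn]] := mule_eq_fin_gt0 _ _ _ (volume_ball1_ge0 _)
  (moment_expRN_ge0 _) (powR_gt0 _ (pi_gt0 R)) (volume_ball1_moment n).
rewrite fineK// ge0_fin_numE ?moment_expRN_ge0//.
by apply: (moment_expRN_lty_le _ (n%:R / 2)); rewrite ?a0// momn ltry.
Qed.

Lemma Gamma_gt0 {R : realType} (a : R) : (0 <= a)%R -> (0 < Gamma (a + 1))%R.
Proof.
move=> a0; rewrite Gamma_moment -lte_fin -moment_expRN_fin//.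
exact: moment_expRN_gt0.
Qed.

(** * The generalized Gaussian density *)

Lemma gg_const_gt0 {R : realType} n (tau s : R) : (0 < s)%R -> (0 < tau)%R ->
  (0 < gg_const n tau s)%R.
Proof.
move=> s0 tau0; rewrite /gg_const divr_gt0// mulr_gt0 ?powR_gt0 ?pi_gt0//.
- by rewrite Gamma_gt0// divr_ge0.
- by rewrite Gamma_gt0// divr_ge0// ltW.
Qed.

Lemma measurable_gg_density {R : realType} n (tau s : R) :
  measurable_fun [set: n.-tuple R] (gg_density tau s).
Proof.
apply: measurable_funM => //.
apply: (measurableT_comp (@measurable_expR R)).
apply: (measurableT_comp (@oppr_measurable R setT)).
apply: measurable_funM => //.
exact: measurable_enorm_powR.
Qed.

Lemma gg_density_gt0 {R : realType} n (tau s : R) (x : n.-tuple R) :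
  (0 < s)%R -> (0 < tau)%R -> (0 < gg_density tau s x)%R.
Proof. by move=> s0 tau0; rewrite mulr_gt0 ?expR_gt0 ?gg_const_gt0. Qed.

Lemma integral_gg_density {R : realType} n (tau s : R) :
  (0 < s)%R -> (0 < tau)%R ->
  \int[@lebesgue_vec R n]_x (gg_density tau s x)%:E = 1.
Proof.
move=> s0 tau0.
have pin0 : (0 < (pi : R) `^ (n%:R / 2))%R := powR_gt0 _ (pi_gt0 R).
have VG := @volume_ball1_moment R n.
have [v0 [vE gE]] := mule_eq_fin_gt0 _ _ _ (volume_ball1_ge0 _)
  (moment_expRN_ge0 _) pin0 VG.
have ns0 : (0 <= n%:R / s)%R by rewrite divr_ge0// ltW.
under eq_integral do rewrite EFinM.
rewrite ge0_integralZl//; last 2 first.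
- apply/measurable_EFinP; apply: (measurableT_comp (@measurable_expR R)).
  apply: (measurableT_comp (@oppr_measurable R setT)).
  apply: measurable_funM => //.
  exact: measurable_enorm_powR.
- by rewrite lee_fin ltW// gg_const_gt0.
rewrite integral_radial_expRN//.
rewrite /gg_const !Gamma_moment.
have : (0 < Gamma (n%:R / s + 1))%R by exact: Gamma_gt0.
rewrite Gamma_moment (moment_expRN_fin _ ns0)/= vE -!EFinM.
(* Replacing pi^(n/2) by the volume of the unit ball times Gamma(n/2 + 1) leaves a purely algebraic
   identity. *)
move: VG; rewrite vE gE -EFinM => -[] vg /=; rewrite -vg in pin0 *.
rewrite powRN => g0; congr EFin; field.
rewrite !gt_eqF ?powR_gt0//=.
by move: pin0; rewrite pmulr_rgt0// => /gt_eqF ->.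
Qed.

(** * Gibbs' inequality *)

(** For a > 0 this is ln t <= t - 1 at t = b / a, multiplied by a; for a = 0 the gap is b. *)
Lemma gibbs_gap_ge0 {R : realType} (a b : R) : (0 <= a)%R -> (0 < b)%R ->
  (0 <= a * ln a - (a * ln b + a - b))%R.
Proof.
rewrite le_eqVlt => /predU1P[<-|a0] b0; first by rewrite !mul0r; lra.
have : (ln (b / a) <= b / a - 1)%R.
  rewrite -{1}(subrKC 1%R (b / a)%R) le_ln1Dx//.
  by rewrite ltrBrDl subrr divr_gt0.
rewrite ln_div ?posrE// => /(ler_wpM2l (ltW a0)).
rewrite !mulrBr mulr1 mulrCA divff ?gt_eqF// mulr1; lra.
Qed.

(** The inequality ln t <= t - 1 is strict unless t = 1, and for a = 0 the gap b is positive. *)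
Lemma gibbs_gap_eq0 {R : realType} (a b : R) : (0 <= a)%R -> (0 < b)%R ->
  (a * ln a - (a * ln b + a - b) = 0)%R -> a = b.
Proof.
rewrite le_eqVlt => /predU1P[<-|a0] b0; first by rewrite !mul0r; lra.
have [//|ab] := eqVneq a b.
have lnba0 : (ln (b / a) != 0)%R.
  apply: contra_neq ab => lnba.
  have ba : (b / a = 1)%R.
    by rewrite -(lnK (x := (b / a)%R)) ?posrE ?divr_gt0// lnba expR0.
  by rewrite -[RHS](divfK (lt0r_neq0 a0)) ba mul1r.
have := expR_gt1Dx lnba0; rewrite lnK ?posrE ?divr_gt0//.
rewrite ln_div ?posrE// -(ltr_pM2l a0) mulrDr mulrBr mulr1.
by rewrite mulrCA divff ?gt_eqF// mulr1; lra.
Qed.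

Section gibbs.
Context d (T : measurableType d) (R : realType).
Variables (mu : {measure set T -> \bar R}) (f g : T -> R).
Hypotheses (mf : measurable_fun setT f) (mg : measurable_fun setT g).
Hypotheses (f0 : forall x, (0 <= f x)%R) (g0 : forall x, (0 < g x)%R).
Hypotheses (f1 : \int[mu]_x (f x)%:E = 1) (g1 : \int[mu]_x (g x)%:E = 1).
Hypothesis ifg : mu.-integrable setT (fun x => (f x * ln (g x))%:E).

Let u x := (f x * ln (f x))%:E.
(* [l] has the integral of f ln g, since f and g both have integral 1, but
   unlike f ln g it is below [u] pointwise. *)
Let l x := (f x * ln (g x))%:E + ((f x)%:E - (g x)%:E).

Let mu_ : measurable_fun setT u.
Proof.
apply/measurable_EFinP; apply: measurable_funM => //.
exact: (measurableT_comp (@measurable_ln R)).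
Qed.

Let integrable_density (h : T -> R) :
  measurable_fun setT h -> (forall x, (0 <= h x)%R) ->
  \int[mu]_x (h x)%:E = 1 -> mu.-integrable setT (fun x => (h x)%:E).
Proof.
move=> mh h0 h1; apply/integrableP; split; first exact/measurable_EFinP.
under eq_integral => x _ do rewrite gee0_abs ?lee_fin//.
by rewrite h1 ltry.
Qed.

Let if_ : mu.-integrable setT (fun x => (f x)%:E).
Proof. exact: integrable_density. Qed.

Let ig : mu.-integrable setT (fun x => (g x)%:E).
Proof. by apply: integrable_density => // x; exact: ltW. Qed.

Let il : mu.-integrable setT l.
Proof. by apply: integrableD => //; exact: integrableB. Qed.

Let integral_l : \int[mu]_x l x = \int[mu]_x (f x * ln (g x))%:E.
Proof.
rewrite integralD//; last exact: integrableB.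
by rewrite integralB// f1 g1 subee// adde0.
Qed.

Let lu x : l x <= u x.
Proof.
rewrite /l /u -EFinB -EFinD lee_fin -subr_ge0.
by rewrite addrA; exact: gibbs_gap_ge0.
Qed.

(** The negative part of [u] is dominated by that of the integrable function [l]. Hence the integral
    of [u] is never an indeterminate difference. *)
Lemma gibbs_integral_neg : \int[mu]_x u^\- x < +oo.
Proof.
apply: (@le_lt_trans _ _ (\int[mu]_x l^\- x)).
  apply: ge0_le_integral => //.
  - exact: measurable_funeneg.
  - apply: measurable_funeneg; exact: measurable_int il.
  - move=> x _; apply: (@funeneg_le _ _ setT l u) => [y _|]; rewrite ?inE//.
exact: (integrable_lty measurableT (integrable_funeneg measurableT il)).
Qed.

Lemma gibbs_integrable : \int[mu]_x u^\+ x < +oo -> mu.-integrable setT u.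
Proof.
move=> upos; apply/integrableP; split => //.
rewrite [X in \int[mu]_x X x](_ : _ = abse \o u)// fune_abse ge0_integralD//.
- by rewrite lte_add_pinfty// gibbs_integral_neg.
- exact: measurable_funepos.
- exact: measurable_funeneg.
Qed.

Lemma gibbs_inequality :
  \int[mu]_x (f x * ln (g x))%:E <= \int[mu]_x u x.
Proof.
have [upos|] := ltP (\int[mu]_x u^\+ x) +oo.
  rewrite -integral_l; apply: le_integral => //; exact: gibbs_integrable.
(* If the positive part has infinite integral, the finite negative part leaves +oo on the right. *)
rewrite leye_eq => /eqP upos; rewrite [leRHS]integralE upos addye ?leey//.
have := gibbs_integral_neg; rewrite lt_neqAle => /andP[uneg _].
by rewrite eqe_oppLR.
Qed.

Lemma gibbs_inequality_eq :
  \int[mu]_x u x = \int[mu]_x (f x * ln (g x))%:E ->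
  ae_eq mu setT (EFin \o f) (EFin \o g).
Proof.
move=> ul.
have fgfin := integrable_fin_num measurableT ifg.
(* An infinite positive part would make the integral of [u] equal to +oo, whereas it equals the
   finite integral of f ln g. *)
have iu : mu.-integrable setT u.
  apply: gibbs_integrable; rewrite ltey; apply/negP => /eqP upos.
  move: ul fgfin; rewrite integralE upos addye; first by move=> <-.
  have := gibbs_integral_neg; rewrite lt_neqAle => /andP[uneg _].
  by rewrite eqe_oppLR.
(* The gap is nonnegative, so a zero integral makes it vanish almost everywhere, and pointwise it
   vanishes only where f = g. *)
have gap0 : \int[mu]_x (u x - l x) = 0.
  by rewrite integralB// ul integral_l subee.
have := ae_eq_integral_abs mu measurableT
  (measurable_int _ (integrableB measurableT iu il)).
move=> [+ _].
rewrite -[X in X = _ -> _](_ : \int[mu]_x (u x - l x) = _); last first.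
  by apply: eq_integral => x _; rewrite gee0_abs// sube_ge0.
move=> /(_ gap0); apply: filterS => x /= /(_ I).
rewrite /u /l -EFinD => -[xgap] _; congr EFin.
by apply: (gibbs_gap_eq0 _ _ (f0 x) (g0 x)); rewrite -addrA.
Qed.

End gibbs.

(** * Densities and expectations of random vectors *)

Section density.
Context {R : realType} {d : measure_display} {T : measurableType d}.
Context {P : probability T R} {n : nat} (X : {RV P >-> n.-tuple R}).
Implicit Types f g : n.-tuple R -> R.

Lemma integral_has_density f : has_density X f ->
  \int[lebesgue_vec n]_x (f x)%:E = 1.
Proof.
by case=> _ _ /(_ setT measurableT) <-; rewrite probability_setT.
Qed.

Lemma integrable_has_density f : has_density X f ->
  (lebesgue_vec n).-integrable setT (EFin \o f).
Proof.
move=> Xf; have [mf f0 _] := Xf.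
apply/integrableP; split; first exact/measurable_EFinP.
under eq_integral => x _ do rewrite gee0_abs ?lee_fin//.
by rewrite integral_has_density// ltry.
Qed.

Lemma has_density_ae_eq f g : has_density X f -> has_density X g ->
  ae_eq (lebesgue_vec n) setT (EFin \o f) (EFin \o g).
Proof.
move=> Xf Xg; apply: integral_ae_eq => //.
- exact: integrable_has_density.
- by apply/measurable_EFinP; case: Xg.
- by move=> A _ mA; case: Xf => _ _ /(_ _ mA) <-; case: Xg => _ _ /(_ _ mA) <-.
Qed.

Lemma ae_eq_has_density f g : has_density X f ->
  measurable_fun [set: n.-tuple R] g -> (forall x, (0 <= g x)%R) ->
  ae_eq (lebesgue_vec n) setT (EFin \o f) (EFin \o g) -> has_density X g.
Proof.
move=> [mf f0 fE] mg g0 fg; split => // A mA.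
rewrite fE//; apply: (@ge0_ae_eq_integral _ _ _ (lebesgue_vec n) A) => //.
- exact/measurable_EFinP/measurable_funTS.
- exact/measurable_EFinP/measurable_funTS.
- by move=> x _; rewrite lee_fin.
- by move=> x _; rewrite lee_fin.
- by apply: filterS fg => x /= fgx _; exact: fgx.
Qed.

(** The expectation is an integral against the law of X, which is absolutely continuous; the change
    of variables uses its Radon-Nikodym derivative, to be identified with f. *)
Lemma ge0_expectation_density f (h : n.-tuple R -> R) : has_density X f ->
  measurable_fun [set: n.-tuple R] h -> (forall x, (0 <= h x)%R) ->
  'E_P[fun w => h (X w)] = \int[lebesgue_vec n]_x (f x * h x)%:E.
Proof.
move=> Xf mh h0; have [mf f0 fE] := Xf.
have mh' : measurable_fun [set: n.-tuple R] (EFin \o h).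
  exact/measurable_EFinP.
rewrite unlock.
rewrite -(@ge0_integral_distribution _ _ _ _ _ _ X (EFin \o h) mh')//.
pose nu := distribution P X.
have dom : nu `<< lebesgue_vec n.
  apply/null_content_dominatesP => A mA A0; rewrite [LHS]fE//.
  apply: (@null_set_integral _ _ _ (lebesgue_vec n) A) => //.
  exact/measurable_EFinP/measurable_funTS.
rewrite -(Radon_Nikodym_SigmaFinite.change_of_variables dom)//.
apply: ae_eq_integral => //.
- apply: emeasurable_funM => //.
  exact: measurable_int (Radon_Nikodym_SigmaFinite.f_integrable dom).
- by apply/measurable_EFinP; exact: measurable_funM.
(* Both functions integrate to the law of X on every measurable set, hence agree almost
   everywhere. *)
- have : ae_eq (lebesgue_vec n) setT
      (Radon_Nikodym_SigmaFinite.f nu (lebesgue_vec n)) (EFin \o f).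
    apply: integral_ae_eq => //.
    + exact: Radon_Nikodym_SigmaFinite.f_integrable.
    + exact/measurable_EFinP.
    + move=> A _ mA; rewrite -Radon_Nikodym_SigmaFinite.f_integral//.
      exact: fE.
  by apply: filterS => x /= /(_ I) -> _; rewrite -EFinM mulrC.
Qed.

End density.

(** The set lies in a box of singletons, whose first side has measure 0. In dimension 0 the only
    point has norm 0 and mass 1. *)
Lemma lebesgue_vec_enorm0 {R : realType} n : (0 < n)%N ->
  (@lebesgue_vec R n).-negligible [set x | enorm x = 0%R].
Proof.
case: n => // n _.
pose B (i : 'I_n.+1) : set (measurableTypeR R) := [set 0%R].
have mB i : measurable (B i) by exact: measurable_set1.
exists [set x | forall i, B i (tnth x i)]; split.
- exact: (measurable_box B mB).
- rewrite [LHS](lebesgue_tuple_box mB) big_ord_recl.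
  by rewrite [X in X * _]lebesgue_measure_set1 mul0e.
- move=> x /= /eqP; rewrite sqrtr_eq0 => x0 i.
  have S0 : (\sum_(i < n.+1) tnth x i ^+ 2 == 0)%R.
    by rewrite eq_le x0 sumr_ge0// => j _; exact: sqr_ge0.
  move: S0; rewrite psumr_eq0; last by move=> j _; exact: sqr_ge0.
  by move=> /allP/(_ i (mem_index_enum _)); rewrite sqrf_eq0 => /eqP.
Qed.

(** A zero moment would force f = 0 almost everywhere, since the norm vanishes only on a null set,
    against f having integral 1. This makes tau = m / (s M) meaningful and positive. *)
Lemma expectation_enorm_gt0 {R : realType} {d : measure_display}
    {T : measurableType d} {P : probability T R} {n : nat}
    (X : {RV P >-> n.-tuple R}) (f : n.-tuple R -> R) (s : R) :
  (0 < n)%N -> has_density X f -> 0 < 'E_P[fun w => (enorm (X w) `^ s)%R].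
Proof.
move=> n0 Xf; have [mf f0 _] := Xf.
have ms := @measurable_enorm_powR R n s.
have mfs : measurable_fun [set: n.-tuple R] (fun x => (f x * enorm x `^ s)%:E).
  by apply/measurable_EFinP; exact: measurable_funM.
rewrite (ge0_expectation_density X f _ Xf ms); last first.
  by move=> x; exact: powR_ge0.
rewrite lt_neqAle integral_ge0 ?andbT; last first.
  by move=> x _; rewrite lee_fin mulr_ge0 ?powR_ge0.
apply/eqP => M0.
have := integral_has_density X f Xf.
rewrite (@ae_eq_integral _ _ _ (lebesgue_vec n) setT (cst 0))//.
- by rewrite integral_cst// mul0e => /eqP; rewrite lt_eqF.
- exact/measurable_EFinP.
have [+ _] := ae_eq_integral_abs (lebesgue_vec n) measurableT mfs.
under eq_integral => x _ do
  rewrite gee0_abs ?lee_fin ?mulr_ge0 ?powR_ge0//.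
move=> /(_ (esym M0)).
have : \forall x \ae @lebesgue_vec R n, enorm x != 0%R.
  have [N [mN N0 sN]] := @lebesgue_vec_enorm0 R n n0.
  by exists N; split => // x /= /negP; rewrite negbK => /eqP; exact: sN.
apply: filterS2 => x /= xn0 /(_ I) [] /eqP.
by rewrite mulf_eq0 powR_eq0 (negbTE xn0) orbF => /eqP ->.
Qed.

(** * The entropy bound and its equality case *)

(** Since tau M = n / s, the left-hand side is the integral of f ln g. *)
Lemma ln_gg_const {R : realType} n (s M : R) :
    (0 < n)%N -> (0 < s)%R -> (0 < M)%R ->
  (ln (gg_const n (n%:R / (s * M)) s) - n%:R / s)%R =
  (- (n%:R / s * ln (c1 n s * M)))%R.
Proof.
move=> n0 s0 M0; rewrite /gg_const /c1.
have nR0 : (0 < n%:R :> R)%R by rewrite ltr0n.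
set G := Gamma (n%:R / 2 + 1)%R; set H := Gamma (n%:R / s + 1)%R.
have G0 : (0 < G)%R by rewrite Gamma_gt0// divr_ge0.
have H0 : (0 < H)%R by rewrite Gamma_gt0// divr_ge0// ltW.
set p := (pi `^ _)%R; have p0 : (0 < p)%R by rewrite powR_gt0 ?pi_gt0.
have e0 := expR_gt0 (1 : R).
(* From here on the Gamma values and the power of pi are arbitrary positive reals. *)
clearbody G H p.
set t := (n%:R / (s * M))%R.
have t0 : (0 < t)%R by rewrite divr_gt0// mulr_gt0.
(* Dividing by M here cancels the factor M that multiplies [c1]. *)
have -> : (s * expR 1 / n%:R = expR 1 / t / M)%R.
  by rewrite /t; field; rewrite !gt_eqF.
clearbody t.
have -> : (ln (G * t `^ (n%:R / s) / (H * p)) =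
    ln G + n%:R / s * ln t - (ln H + ln p))%R.
  rewrite ln_div ?posrE ?mulr_gt0 ?powR_gt0//.
  by rewrite lnM ?posrE ?powR_gt0// ln_powR lnM.
rewrite -(mulrA (powR _ _)) divfK ?gt_eqF//.
have -> : (ln ((p * H / G) `^ (s / n%:R) * (expR 1 / t)) =
    s / n%:R * (ln p + ln H - ln G) + (1 - ln t))%R.
  rewrite lnM ?posrE ?powR_gt0 ?divr_gt0 ?mulr_gt0// ln_powR.
  by rewrite !ln_div ?posrE ?mulr_gt0// lnM// expRK.
by field; rewrite !gt_eqF.
Qed.

(** The moment controls only the positive part of - f ln f. Finiteness from below is therefore
    stated under integrability of the positive part of f ln f. *)
Theorem theorem4 (R : realType) (d : measure_display) (T : measurableType d)
    (P : probability T R) (m : nat) (X : {RV P >-> m.-tuple R})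
    (f : m.-tuple R -> R) (s : R) :
  (1 <= m)%N ->
  has_density X f ->
  full_support f ->
  (0 < s)%R ->
  'E_P[fun w => (enorm (X w) `^ s)%R] < +oo ->
  let M : R := fine 'E_P[fun w => (enorm (X w) `^ s)%R] in
  let bound : R := (m%:R / s * ln (c1 m s * M))%R in
  [/\ entropy f < +oo,
      \int[lebesgue_tuple m]_x (fun y => (f y * ln (f y))%:E)^\+ x < +oo ->
        entropy f \is a fin_num,
      entropy f <= bound%:E &
      entropy f = bound%:E <-> has_density X (gg_density (m%:R / (s * M))%R s)].
Proof.
move=> m0 Xf _ s0 Efin M bound.
have [mf f0 _] := Xf.
pose mu := @lebesgue_vec R m.
have E0 := expectation_enorm_gt0 X f s m0 Xf.
have EM : 'E_P[fun w => (enorm (X w) `^ s)%R] = M%:E.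
  by rewrite /M fineK// ge0_fin_numE// ltW.
have M0 : (0 < M)%R by rewrite -lte_fin -EM.
pose tau := (m%:R / (s * M))%R.
have tau0 : (0 < tau)%R by rewrite divr_gt0 ?ltr0n// mulr_gt0.
pose g := @gg_density R m tau s; rewrite -/tau -/g.
have g0 x : (0 < g x)%R by exact: gg_density_gt0.
have mg : measurable_fun [set: m.-tuple R] g by exact: measurable_gg_density.
pose c := gg_const m tau s.
have lng x : ln (g x) = (ln c - tau * enorm x `^ s)%R.
  by rewrite lnM ?posrE ?expR_gt0 ?gg_const_gt0// expRK.
have ms := @measurable_enorm_powR R m s.
have EfM : \int[mu]_x (f x * enorm x `^ s)%:E = M%:E.
  rewrite -EM (ge0_expectation_density X f _ Xf ms)// => x.
  exact: powR_ge0.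
have iM : mu.-integrable setT (fun x => (f x * enorm x `^ s)%:E).
  apply/integrableP; split.
    by apply/measurable_EFinP; exact: measurable_funM.
  under eq_integral => x _ do rewrite gee0_abs ?lee_fin ?mulr_ge0 ?powR_ge0//.
  by rewrite EfM ltry.
have f1 := integral_has_density X f Xf.
have if_ := integrable_has_density X f Xf.
(* A combination of f and f |x|^s, both integrable with known integrals 1 and M. *)
have flngE x : (f x * ln (g x))%:E =
    (ln c)%:E * (f x)%:E - tau%:E * (f x * enorm x `^ s)%:E.
  by rewrite lng -!EFinM -EFinB mulrBr (mulrC (f x)) (mulrCA (f x)).
have ifg : mu.-integrable setT (fun x => (f x * ln (g x))%:E).
  under eq_fun do rewrite flngE.
  by apply: integrableB => //; exact: integrableZl.
have fgE : \int[mu]_x (f x * ln (g x))%:E = (- bound)%:E.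
  under eq_integral do rewrite flngE.
  rewrite integralB//; [|exact: integrableZl..].
  rewrite !integralZl// EfM f1 mule1 -EFinM -EFinB.
  rewrite /bound -ln_gg_const//; congr (_ - _)%:E.
  by rewrite /tau; field; rewrite !gt_eqF.
have g1 : \int[mu]_x (g x)%:E = 1 := integral_gg_density m tau s s0 tau0.
have entE : entropy f = - \int[mu]_x (f x * ln (f x))%:E by [].
have gibbs := gibbs_inequality _ _ _ mu f g mf mg f0 g0 f1 g1 ifg.
rewrite fgE in gibbs.
have entle : entropy f <= bound%:E by rewrite entE leeNl -EFinN.
split => //.
- exact: le_lt_trans entle (ltry _).
- move=> fpos; rewrite entE fin_numN; apply: integrable_fin_num => //.
  exact: (gibbs_integrable _ _ _ mu f g mf mg f0 g0 f1 g1 ifg fpos).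
split => [entb|Xg].
  apply: (ae_eq_has_density X f g Xf mg); first by move=> x; exact: ltW.
  apply: (gibbs_inequality_eq _ _ _ mu f g mf mg f0 g0 f1 g1 ifg).
  by rewrite fgE EFinN -entb entE oppeK.
(* Conversely, two densities of X agree almost everywhere, so f ln f and f ln g have the same
   integral. *)
rewrite entE; apply/eqP; rewrite eqe_oppLR; apply/eqP.
rewrite -EFinN -fgE; apply: ae_eq_integral => //.
- apply/measurable_EFinP; apply: measurable_funM => //.
  exact: (measurableT_comp (@measurable_ln R)).
- exact: measurable_int ifg.
- have := has_density_ae_eq X f g Xf Xg.
  by apply: filterS => x /= /(_ I)[] {2}->.
Qed.
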